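(* Let $\chi:\mathbb{R}^+\to\mathbb{R}$ be a kernel, let $f:\mathbb{R}^{+}\rightarrow\mathbb{R}$ be a bounded measurable function with a non-removable jump discontinuity at $t\in\mathbb{R}^{+}$, and let $\alpha \in \mathbb{R}$. Suppose that $\chi(u)=0$ for every $u\in(1,e)$. Then the following statements are equivalent: (i) $\displaystyle \lim_{\substack{w \rightarrow \infty\\ w\log t\notin \mathbb{Z}}} (I_w^{\chi}f)(t)=\alpha f(t+0)+(1-\alpha)f(t-0)$; (ii) $\psi_{\chi}^{-}(u)=\alpha$ for every $u \in(1, e)$; (iii) $\psi_{\chi}^{+}(u)=1-\alpha$ for every $u\in(1, e)$.
   Context: $\mathbb{R}^+$ denotes the positive real numbers. A function $\chi:\mathbb{R}^+\to\mathbb{R}$ is called a kernel if: (i) $\chi\in L^1(\mathbb{R}^+)$ and $\chi$ is bounded on $[1/e,e]$; (ii) $\sum_{k=-\infty}^{+\infty}\chi(e^{-k}u)=1$ for every $u\in\mathbb{R}^+$; (iii) for some $\nu>0$, $\sup_{u\in\mathbb{R}^+}\sum_{k=-\infty}^{+\infty}|\chi(e^{-k}u)|\,|k-\log u|^{\nu}<+\infty$. For $w>0$ and bounded measurable $f:\mathbb{R}^+\to\mathbb{R}$, the Kantorovich exponential sampling series is \[(I_{w}^{\chi}f)(x)= \sum_{k= - \infty}^{+\infty} \chi(e^{-k} x^{w})\, w \int_{k/w}^{(k+1)/w} f(e^{u})\, du,\quad x\in\mathbb{R}^+.\] The one-sided limits are $f(t+0):=\lim_{y\to0^+}f(t+y)$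 and $f(t-0):=\lim_{y\to0^+}f(t-y)$; $f$ has a non-removable jump discontinuity at $t$ if both exist, are finite, and are different. For $u\in\mathbb{R}^+$, $\psi_\chi^+(u):=\sum_{k\in\mathbb{Z},\,k<\log u}\chi(ue^{-k})$ and $\psi_\chi^-(u):=\sum_{k\in\mathbb{Z},\,k>\log u}\chi(ue^{-k})$. The limit in (i) is taken as $w\to\infty$ through those $w>0$ with $w\log t\notin\mathbb{Z}$.
   Formalization: The formal theorem assumes in addition that t ≠ 1: for t = 1 the number w log t = 0 is always an integer, so the limit in (i) is taken over an empty set of w and is undefined (read vacuously, the equivalence would be false). *)

(* Defs.v *)
From HB Require Import structures.
From mathcomp Require Import all_boot all_order all_algebra.
From mathcomp Require Import all_classical all_reals all_analysis.
Set Implicit Arguments.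
Unset Strict Implicit.
Unset Printing Implicit Defensive.
Import Order.TTheory GRing.Theory Num.Theory.
Import numFieldNormedType.Exports.
Local Open Scope classical_set_scope.
Local Open Scope ring_scope.

(* Functions on the positive reals are represented by functions R -> R whose
   values outside Rplus are never used. *)
Definition Rplus {R : realType} : set R := [set x | 0 < x].

(* Measurability and integrals are taken in the sense of Lebesgue, i.e. with
   respect to the completion of the Borel sigma-algebra. [lebesgueR R] is R
   equipped with the sigma-algebra of [completed_lebesgue_measure]. *)
Notation lebesgueR R := (caratheodory_type (@wlength R idfun)^*%mu).

Definition lebesgue_measurable {R : realType} (D : set R) (f : R -> R) : Prop :=
  @measurable_fun _ _ (lebesgueR R) R D f.

Definition lebesgue_L1 {R : realType} (D : set R) (f : R -> R) : Prop :=
  (@completed_lebesgue_measure R).-integrable D (EFin \o f).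

Section SumZ.
Context {R : realType}.
Implicit Types a : int -> R.

(* [Negz n] is - n.+1. *)
Definition cvgZ a : Prop :=
  cvgn (series (fun n => a (Posz n))) /\ cvgn (series (fun n => a (Negz n))).

(* Meaningful when [cvgZ a]; every sum below taken for a kernel is absolutely
   convergent by the moment condition (the last clause of [is_kernel]). *)
Definition sumZ a : R :=
  limn (series (fun n => a (Posz n))) + limn (series (fun n => a (Negz n))).

End SumZ.

Section Kantorovich.
Context {R : realType}.
Implicit Types (chi f : R -> R) (w x t u : R).

Definition abs_moment chi (nu u : R) : \bar R :=
  \esum_(k in [set: int])
    (`|chi (expR (- k%:~R) * u)| * `|k%:~R - ln u| `^ nu)%:E.

Definition is_kernel chi : Prop :=
  [/\ lebesgue_L1 Rplus chi /\ [bounded chi u | u in `[expR (-1), expR 1]],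
      forall u, 0 < u ->
        cvgZ (fun k => chi (expR (- k%:~R) * u)) /\
        sumZ (fun k => chi (expR (- k%:~R) * u)) = 1
    & exists2 nu : R, 0 < nu &
        (ereal_sup [set abs_moment chi nu u | u in Rplus] < +oo)%E].

Definition kantorovich chi f w x : R :=
  sumZ (fun k => chi (expR (- k%:~R) * x `^ w) *
    (w * \int[completed_lebesgue_measure]_(u in
            [set` `[k%:~R / w, (k + 1)%:~R / w]]) f (expR u))).

Definition right_lim f t : R := lim (f x @[x --> t^'+]).
Definition left_lim f t : R := lim (f x @[x --> t^'-]).

Definition jump_discontinuity f t : Prop :=
  [/\ cvg (f x @[x --> t^'+]), cvg (f x @[x --> t^'-])
    & right_lim f t <> left_lim f t].

Definition psi_plus chi u : R :=
  sumZ (fun k => if k%:~R < ln u then chi (u * expR (- k%:~R)) else 0).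

Definition psi_minus chi u : R :=
  sumZ (fun k => if ln u < k%:~R then chi (u * expR (- k%:~R)) else 0).

(* w tends to +oo through the w > 0 with w * ln t not an integer. For t = 1
   there is no such w: the filter is then the improper one, and every limit
   along it holds vacuously. *)
Definition nonint_infty t : set_system R :=
  within [set w | 0 < w /\ w * ln t \isn't a Num.int] +oo.

End Kantorovich.

(* Main.v *)
(* Write L = w log t. Since chi vanishes on (1, e), the term k = floor L of
   the series drops out, and every remaining mean is taken over an interval
   lying strictly on one side of log t. The moment condition makes the terms
   with |k - L| of order w negligible, so that
     I_w f(t) = f(t+0) psi^-(t^w) + f(t-0) psi^+(t^w) + o(1)
   along w log t not in Z. Moreover u |-> psi^-(u) is invariant under
   multiplication by e, and psi^- + psi^+ = 1 off the powers of e. As t <> 1,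
   each u in (1, e) is, modulo powers of e, of the form t^w for arbitrarily
   large w; this gives the converse implication. *)
Require Import Defs.
From mathcomp Require Import all_boot all_order all_algebra.
From mathcomp Require Import all_classical all_reals all_analysis.
From mathcomp Require Import lra zify.
Import Order.TTheory GRing.Theory Num.Theory.
Import numFieldNormedType.Exports.
Local Open Scope classical_set_scope.
Local Open Scope ring_scope.

Set Implicit Arguments.
Unset Strict Implicit.

(** * Linearity and shift invariance of two-sided series *)

Lemma cvgZD (R : realType) (a b : int -> R) : Defs.cvgZ a -> Defs.cvgZ b ->
  Defs.cvgZ (fun k => a k + b k).
Proof.
by move=> [aP aN] [bP bN]; split; [exact: is_cvg_seriesD aP bP|
  exact: is_cvg_seriesD aN bN].
Qed.

Lemma cvgZM (R : realType) (c : R) (a : int -> R) : Defs.cvgZ a ->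
  Defs.cvgZ (fun k => c * a k).
Proof.
by move=> [aP aN]; split; [exact: is_cvg_seriesZ aP|exact: is_cvg_seriesZ aN].
Qed.

Lemma sumZD (R : realType) (a b : int -> R) : Defs.cvgZ a -> Defs.cvgZ b ->
  sumZ (fun k => a k + b k) = sumZ a + sumZ b.
Proof.
move=> [aP aN] [bP bN]; rewrite /sumZ.
rewrite (lim_seriesD aP bP) (lim_seriesD aN bN).
by rewrite addrACA.
Qed.

Lemma sumZM (R : realType) (c : R) (a : int -> R) : Defs.cvgZ a ->
  sumZ (fun k => c * a k) = c * sumZ a.
Proof.
by move=> [aP aN]; rewrite /sumZ mulrDr (lim_seriesZ c aP) (lim_seriesZ c aN).
Qed.

(** The shift moves the single term [a 0] from the nonnegative half to the negative half, so the
    total is unchanged. *)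
Lemma sumZ_succ (R : realType) (a : int -> R) : Defs.cvgZ a ->
  Defs.cvgZ (fun k => a (k + 1)) /\ sumZ (fun k => a (k + 1)) = sumZ a.
Proof.
move=> [aP aN].
have hP : series (fun n => a (Posz n + 1)) @ \oo -->
    limn (series (fun n => a (Posz n))) - a 0.
  have -> : series (fun n => a (Posz n + 1)) =
      (fun n => series (fun n => a (Posz n)) n.+1 - a 0).
    apply/funext => n; rewrite /series /= big_nat_recl// addrC addKr.
    by apply: eq_bigr => i _; rewrite -PoszD addn1.
  apply: cvgB; last exact: cvg_cst.
  by rewrite (cvg_shiftS (series (fun n => a (Posz n)))).
have hN : series (fun n => a (Negz n + 1)) @ \oo -->
    a 0 + limn (series (fun n => a (Negz n))).
  rewrite -(cvg_shiftS (series (fun n => a (Negz n + 1)))).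
  have -> : (fun n => series (fun n => a (Negz n + 1)) n.+1) =
      (fun n => a 0 + series (fun n => a (Negz n)) n).
    apply/funext => n; rewrite /series /= big_nat_recl//; congr (_ + _).
    apply: eq_bigr => i _; congr (a _).
    by rewrite !NegzE -addn1 PoszD opprD addrNK.
  by apply: cvgD; [exact: cvg_cst|].
split; first by split; [apply: cvgP hP|apply: cvgP hN].
rewrite /sumZ (cvg_lim _ hP)// (cvg_lim _ hN)//.
by rewrite addrA addrNK.
Qed.

Lemma sumZ_shift (R : realType) (a : int -> R) (m : int) :
    (forall m, Defs.cvgZ (fun k => a (k + m))) ->
  sumZ (fun k => a (k + m)) = sumZ a.
Proof.
move=> ca.
have step i : sumZ (fun k => a (k + (i + 1))) = sumZ (fun k => a (k + i)).
  rewrite -(sumZ_succ (ca i)).2; congr sumZ.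
  by apply/funext => k; rewrite addrAC addrA.
have -> : sumZ a = sumZ (fun k => a (k + 0)).
  by congr sumZ; apply/funext => k; rewrite addr0.
elim/int_ind : m => [//|n <-|n <-].
- by rewrite intS addrC step.
- by rewrite intS opprD addrC -step subrK.
Qed.

(** * Absolutely summable families over the integers *)

(* Quantifying over finite index sets makes absolute summability independent
   of the way [sumZ] splits int into two halves. *)
Definition abs_sums_le (R : realType) (a : int -> R) (M : R) : Prop :=
  forall s : seq int, uniq s -> \sum_(k <- s) `|a k| <= M.

Lemma abs_sums_le_sumZ (R : realType) (a : int -> R) (M : R) :
  abs_sums_le a M -> Defs.cvgZ a /\ `|sumZ a| <= M.
Proof.
move=> aM.
(* Initial segments of both halves form one duplicate-free list, so [M] bounds them jointly;
   bounding each half separately would only give [2 * M]. *)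
have sumE (n m : nat) : [normed series (fun n => a (Posz n))] n +
    [normed series (fun n => a (Negz n))] m <= M.
  have := aM ([seq Posz i | i <- index_iota 0 n] ++ [seq Negz i | i <- index_iota 0 m]).
  rewrite big_cat !big_map; apply.
  rewrite cat_uniq !map_inj_uniq ?iota_uniq//=; try by move=> ? ? [].
  by rewrite andbT; apply/hasPn => k /mapP[i _ ->]; apply/negP => /mapP[j _].
have cv (u : nat -> R) : (forall n, [normed series u] n <= M) ->
    cvgn [normed series u].
  move=> uM; apply: nondecreasing_is_cvgn.
    by apply: nondecreasing_series => n _ _ /=.
  by exists M => _ [n _ <-].
have s0 (u : nat -> R) n : 0 <= [normed series u] n by rewrite /series /= sumr_ge0.
have cP : cvgn [normed series (fun n => a (Posz n))].
  by apply: cv => n; rewrite (le_trans _ (sumE n 0%N))// lerDl.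
have cN : cvgn [normed series (fun n => a (Negz n))].
  by apply: cv => n; rewrite (le_trans _ (sumE 0%N n))// lerDr.
split; first by split; exact: normed_cvg.
rewrite /sumZ (le_trans (ler_normD _ _))//.
rewrite (le_trans (lerD (lim_series_norm cP) (lim_series_norm cN)))//.
rewrite -limD//; apply: limr_le; first exact: is_cvgD.
by near=> n; exact: sumE.
Unshelve. all: by end_near.
Qed.

Lemma abs_sums_le_cvgZ (R : realType) (a : int -> R) (M : R) :
  abs_sums_le a M -> Defs.cvgZ a.
Proof. by case/abs_sums_le_sumZ. Qed.

Lemma abs_sums_leD (R : realType) (a b c : int -> R) (A B : R) :
    (forall k, `|c k| <= `|a k| + `|b k|) ->
  abs_sums_le a A -> abs_sums_le b B -> abs_sums_le c (A + B).
Proof.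
move=> cab aA bB s us.
rewrite (le_trans (ler_sum _ (fun i _ => cab i)))// big_split/=.
by rewrite lerD ?aA ?bB.
Qed.

Lemma abs_sums_leZ (R : realType) (a : int -> R) (A r : R) :
  abs_sums_le a A -> abs_sums_le (fun k => r * a k) (`|r| * A).
Proof.
move=> aA s us; under eq_bigr do rewrite normrM.
by rewrite -mulr_sumr ler_wpM2l ?aA.
Qed.

Lemma abs_sums_le_le (R : realType) (a b : int -> R) (A : R) :
  (forall k, `|b k| <= `|a k|) -> abs_sums_le a A -> abs_sums_le b A.
Proof.
by move=> ba aA s us; rewrite (le_trans (ler_sum _ (fun i _ => ba i)))// aA.
Qed.

Lemma abs_sums_le1 (R : realType) (m : int) (B : R) :
  abs_sums_le (fun k => if k == m then B else 0) `|B|.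
Proof.
move=> s us; under eq_bigr do rewrite (fun_if Num.norm) normr0.
rewrite -big_mkcond /=; have [ms|ms] := boolP (m \in s).
  by rewrite -big_filter (eq_filter (a2 := pred1 m))// filter_pred1_uniq// big_seq1.
rewrite big_seq_cond big_pred0 // => k; apply/negP => /andP[ks /eqP km].
by rewrite km (negbTE ms) in ks.
Qed.

(** * Integral means over short intervals *)

(* The integral of a nonnegative function is a supremum over the simple
   functions below it, so monotonicity needs no measurability; this spares
   showing that f o exp is Lebesgue measurable. *)
Lemma le_integral_nonmeasurable d (T : measurableType d) (R : realType)
  (mu : {measure set T -> \bar R}) (D : set T) (f g : T -> \bar R) :
  (forall x, D x -> (f x <= g x)%E) ->
  (\int[mu]_(x in D) f x <= \int[mu]_(x in D) g x)%E.
Proof.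
move=> fg; rewrite /integral.
have le x : ((f \_ D) x <= (g \_ D) x)%E.
  by rewrite !patchE; case: ifPn => // /set_mem /fg.
apply: leeB; apply: ereal_sup_le => _ /= [h hf <-]; exists h => // x;
  apply: le_trans (hf x) _; rewrite ?funeposE ?funenegE.
- by rewrite ge_max !le_max le lexx orbT.
- by rewrite ge_max !le_max leeN2 le lexx orbT.
Qed.

(** The interval has length [1 / w], so the integral is squeezed between [(c - e) / w] and
    [(c + e) / w]. *)
Lemma mean_close (R : realType) (w c e : R) (g : R -> R) (k : int) : 0 < w ->
    (forall u, k%:~R / w <= u <= (k + 1)%:~R / w -> `|g u - c| <= e) ->
  `|w * \int[completed_lebesgue_measure]_(u in
         [set` `[k%:~R / w, (k + 1)%:~R / w]]) g u - c| <= e.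
Proof.
move=> w0 gc; set D := [set` _].
have mD : completed_lebesgue_measure D = (w^-1)%:E :> \bar R.
  (* Completion enlarges the sigma-algebra but keeps the same set function. *)
  transitivity (@lebesgue_measure R D); first by [].
  rewrite lebesgue_measure_itv/= lte_fin ltr_pM2r ?invr_gt0// ltr_int.
  by rewrite ltrDl ltr01 -EFinB -mulrBl -intrB addrAC subrr add0r mul1r.
have cD r : (\int[completed_lebesgue_measure]_(x in D) (cst r%:E) x
    = (r / w)%:E)%E.
  rewrite integral_cst; first by rewrite EFinM; congr (_ * _)%E.
  have : measurable (D : set (measurableTypeR R)) by exact: measurable_itv.
  exact: sub_caratheodory.
have h1 : ((((c - e) / w)%:E <= \int[completed_lebesgue_measure]_(x in D) (g x)%:E)%E).
  rewrite -cD; apply: le_integral_nonmeasurable => x; rewrite /D /= in_itv/= => /gc.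
  by rewrite ler_distl lee_fin => /andP[].
have h2 : (\int[completed_lebesgue_measure]_(x in D) (g x)%:E <= ((c + e) / w)%:E)%E.
  rewrite -cD; apply: le_integral_nonmeasurable => x; rewrite /D /= in_itv/= => /gc.
  by rewrite ler_distl lee_fin => /andP[].
(* The two finite bounds exclude an infinite integral, for which the real-valued integral would be a
   default value. *)
rewrite /Rintegral; move: h1 h2; case: integral => [r||]//=.
rewrite !lee_fin => h1 h2.
rewrite ler_distl mulrC; apply/andP; split.
  by rewrite -ler_pdivrMr.
by rewrite -ler_pdivlMr.
Qed.

(** * Uniform bounds for a kernel *)

Lemma bounded_setP (R : realType) (f : R -> R) (A : set R) :
  [bounded f x | x in A] -> exists B, forall x, A x -> `|f x| <= B.
Proof.
move=> [B [_ hB]]; exists (B + 1) => x Ax.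
by apply: (hB (B + 1)) => //; rewrite ltrDl.
Qed.

Lemma abs_moment_sums (R : realType) (chi : R -> R) (nu L M : R) :
    (abs_moment chi nu (expR L) <= M%:E)%E ->
  abs_sums_le (fun k => chi (expR (L - k%:~R)) * `|k%:~R - L| `^ nu) M.
Proof.
move=> cM s us; rewrite -lee_fin (le_trans _ cM)//.
apply: esum_ge; exists [set` s]; first by split => //; exact: finite_seq.
rewrite -fsbig_seq// -sumEFin le_eqVlt; apply/orP; left; apply/eqP.
apply: eq_bigr => k _; rewrite normrM (ger0_norm (powR_ge0 _ _)) expRK.
by rewrite -expRD addrC.
Qed.

(** Where [|k - L| >= 1] the weight is at least 1, so the moment dominates the absolute sum. The at
    most two remaining indices, [floor L] and [floor L + 1], put the argument of [chi] in
    [[1/e, e]], where [chi] is bounded. *)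
Lemma kernel_bounds (R : realType) (chi : R -> R) : is_kernel chi ->
  exists nu M C : R, [/\ 0 < nu,
    forall L, abs_sums_le
      (fun k => chi (expR (L - k%:~R)) * `|k%:~R - L| `^ nu) M &
    forall L, abs_sums_le (fun k => chi (expR (L - k%:~R))) C].
Proof.
move=> [[_ /bounded_setP[B hB]] _ [nu nu0 hsup]].
set S := ereal_sup _ in hsup.
have leS L : (abs_moment chi nu (expR L) <= S)%E.
  by apply: ereal_sup_ubound; exists (expR L) => //; exact: expR_gt0.
have S0 : (0 <= S)%E.
  apply: le_trans (leS 0); apply: esum_ge0 => k _.
  by rewrite /= lee_fin mulr_ge0// powR_ge0.
have SE : S = (fine S)%:E by rewrite fineK// ge0_fin_numE.
have hM L : abs_sums_le
    (fun k => chi (expR (L - k%:~R)) * `|k%:~R - L| `^ nu) (fine S).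
  by apply: abs_moment_sums; rewrite -SE.
exists nu, (fine S), (fine S + (`|B| + `|B|)); split => // L.
pose m := Num.floor L.
pose b k : R := (if k == m then B else 0) + (if k == m + 1 then B else 0).
apply: (@abs_sums_leD _ _ b _ _ _ _ (hM L)); last first.
  apply: abs_sums_leD (abs_sums_le1 m B) (abs_sums_le1 (m + 1) B) => k.
  exact: ler_normD.
move=> k; have [kL|kL] := leP 1 `|k%:~R - L|.
  rewrite (@le_trans _ _ (`|chi (expR (L - k%:~R)) * `|k%:~R - L| `^ nu|))//.
    rewrite normrM ler_peMr// ger0_norm ?powR_ge0//.
    by rewrite -{1}(powRr0 `|k%:~R - L|) ler_powR// ltW.
  by rewrite lerDl.
have Bk : `|chi (expR (L - k%:~R))| <= B.
  apply: hB; rewrite /= in_itv/= !ler_expR.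
  by move: kL; rewrite ltr_norml => /andP[? ?]; lra.
rewrite (le_trans Bk)// (le_trans (ler_norm _))//.
have /andP[m1 m2] := floor_itv L; rewrite -/m in m1 m2.
move: kL; rewrite ltr_norml => /andP[k1 k2].
have : (k == m) || (k == m + 1).
  have : (m - 1 < k)%R by rewrite -(ltr_int R) intrD; move: m2; rewrite intrD; lra.
  have : (k < m + 2)%R by rewrite -(ltr_int R); move: m2; rewrite !intrD; lra.
  by move=> h1 h2; lia.
move=> kE; have -> : b k = B; last by rewrite lerDr.
rewrite /b; case: (eqVneq k m) => km; case: (eqVneq k (m + 1)) => km1 //=;
  rewrite ?addr0 ?add0r//; exfalso; lia.
Qed.

(** * The truncated sums in the logarithmic variable *)

Section kernel.
Context {R : realType} (chi : R -> R) (hchi : is_kernel chi).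
Implicit Types (L : R) (k : int).

Let abs_chi L : exists C, abs_sums_le (fun k => chi (expR (L - k%:~R))) C.
Proof. by have [nu [M [C [_ _ hC]]]] := kernel_bounds hchi; exists C. Qed.

Lemma cvgZ_kernel_if (p : int -> bool) L :
  Defs.cvgZ (fun k => if p k then chi (expR (L - k%:~R)) else 0).
Proof.
have [C hC] := abs_chi L; apply: (@abs_sums_le_cvgZ _ _ C).
by apply: abs_sums_le_le hC => k; case: (p k) => //; rewrite normr0.
Qed.

Lemma psi_minusE L : psi_minus chi (expR L) =
  sumZ (fun k => if L < k%:~R then chi (expR (L - k%:~R)) else 0).
Proof.
by congr sumZ; apply/funext => k; rewrite expRK -expRD.
Qed.

Lemma psi_plusE L : psi_plus chi (expR L) =
  sumZ (fun k => if k%:~R < L then chi (expR (L - k%:~R)) else 0).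
Proof.
by congr sumZ; apply/funext => k; rewrite expRK -expRD.
Qed.

(** Each term depends only on [L - k], so adding [m] to [L] just translates the summation index. *)
Lemma psi_minus_periodic L (m : int) :
  psi_minus chi (expR (L + m%:~R)) = psi_minus chi (expR L).
Proof.
rewrite !psi_minusE.
pose a k := if L < k%:~R then chi (expR (L - k%:~R)) else 0.
have aE i k : a (k - i) =
    if L + i%:~R < k%:~R then chi (expR (L + i%:~R - k%:~R)) else 0.
  rewrite /a intrB ltrBrDr (_ : L - (k%:~R - i%:~R) = L + i%:~R - k%:~R)//; lra.
rewrite -/(sumZ a) -(sumZ_shift (a := a) (- m)); last first.
  move=> i; rewrite -(opprK i); under eq_fun do rewrite aE.
  exact: cvgZ_kernel_if.
by congr sumZ; apply/funext => k; rewrite aE.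
Qed.

(** No index equals [L], so the two truncations together contain every term of the series, whose sum
    is 1, exactly once. *)
Lemma psi_minus_plus L : L \isn't a Num.int ->
  psi_minus chi (expR L) + psi_plus chi (expR L) = 1.
Proof.
move=> LZ; rewrite psi_minusE psi_plusE -sumZD; [|exact: cvgZ_kernel_if..].
have [_ /(_ (expR L) (expR_gt0 _)) [_ s1] _] := hchi.
rewrite -[RHS]s1; congr sumZ; apply/funext => k; rewrite -expRD [- _ + L]addrC.
case: (ltgtP L k%:~R) => [_|_|Lk]; rewrite ?addr0 ?add0r//.
by move: LZ; rewrite Lk intr_int.
Qed.

End kernel.

(** * The jump and the limit in epsilon form *)

Lemma near_log (R : realType) (t : R) (P : R -> Prop) : 0 < t ->
  (\forall x \near t, P x) ->
  exists2 d : R, 0 < d & forall u, `|u - ln t| < d -> P (expR u).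
Proof.
move=> t0; rewrite -{1}(lnK t0) => /(@continuous_expR R (ln t)).
move=> /nbhs_ballP[d /= d0 hd]; exists d => // u ud.
by apply: hd; rewrite /ball /= distrC.
Qed.

Lemma jump_log (R : realType) (f : R -> R) (t e : R) : 0 < t -> 0 < e ->
    jump_discontinuity f t ->
  exists2 d : R, 0 < d & forall u, `|u - ln t| < d ->
    (ln t < u -> `|f (expR u) - right_lim f t| <= e) /\
    (u < ln t -> `|f (expR u) - left_lim f t| <= e).
Proof.
move=> t0 e0 [cr cl _].
have hr : \forall x \near t, t < x -> `|right_lim f t - f x| <= e.
  by move/cvgrPdist_le : cr => /(_ _ e0).
have hl : \forall x \near t, x < t -> `|left_lim f t - f x| <= e.
  by move/cvgrPdist_le : cl => /(_ _ e0).
have [d d0 hd] := near_log t0 (filterI hr hl).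
exists d => // u /hd[ur ul]; rewrite ![`|f _ - _|]distrC; split => tu.
  by apply: ur; rewrite -(lnK t0) ltr_expR.
by apply: ul; rewrite -(lnK t0) ltr_expR.
Qed.

Lemma nonint_inftyP (R : realType) (t l : R) (g : R -> R) :
  g w @[w --> nonint_infty t] --> l <->
  forall e : R, 0 < e -> exists A : R, forall w, A < w -> 0 < w ->
    w * ln t \isn't a Num.int -> `|g w - l| <= e.
Proof.
have F : Filter (nonint_infty t) by exact: within_filter.
split=> [/cvgrPdist_le h e /h|h].
  move=> [A [_ hA]]; exists A => w Aw w0 wZ.
  by rewrite distrC; apply: hA.
apply/cvgrPdist_le => e /h[A hA].
exists A; split; first exact: num_real.
by move=> w Aw [w0 wZ]; rewrite distrC; apply: hA.
Qed.

(** Beyond this threshold [d * w] exceeds both 1 and the [nu]-th root of [K]. *)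
Lemma near_infty_powR_ge (R : realType) (nu d K : R) : 0 < nu -> 0 < d -> 0 <= K ->
  exists A : R, forall w, A < w -> 1 <= d * w /\ K <= (d * w) `^ nu.
Proof.
move=> nu0 d0 K0; exists ((1 + K `^ nu^-1) / d) => w.
rewrite ltr_pdivrMr// [w * d]mulrC => /ltW h.
have h0 := powR_ge0 K nu^-1; split; first by lra.
have -> : K = (K `^ nu^-1) `^ nu by rewrite -powRrM mulVf ?gt_eqF// powRr1.
by apply: ge0_ler_powR; rewrite ?nnegrE ?(ltW nu0)//; lra.
Qed.

(** * Asymptotics of the Kantorovich series at a jump *)

(** Replacing each mean by the one-sided limit [c k] on the side of [k] gives the main term. Indices
    close to [L] contribute a small error by the jump estimate, distant ones by the moment bound;
    each share is at most [e / 2]. *)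
Lemma kantorovich_asymp (R : realType) (chi f : R -> R) (t e : R) :
    is_kernel chi -> [bounded f x | x in Rplus] -> 0 < t ->
    jump_discontinuity f t ->
    (forall u : R, 1 < u < expR 1 -> chi u = 0) -> 0 < e ->
  exists A : R, forall w, A < w -> 0 < w -> w * ln t \isn't a Num.int ->
    `|kantorovich chi f w t -
      (right_lim f t * psi_minus chi (expR (w * ln t)) +
       left_lim f t * psi_plus chi (expR (w * ln t)))| <= e.
Proof.
move=> hchi /bounded_setP[B hB] t0 hjump chi0 e0.
have [nu [M [C [nu0 hM hC]]]] := kernel_bounds hchi.
have M0 : 0 <= M by have := hM 0 [::] isT; rewrite big_nil.
have C0 : 0 <= C by have := hC 0 [::] isT; rewrite big_nil.
set fR := right_lim f t; set fL := left_lim f t.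
(* Chosen so that [e1 * C <= e / 2]; the [+ 1] keeps the denominator positive when [C = 0]. *)
have e10 : 0 < e / (2 * (C + 1)) by rewrite divr_gt0// mulr_gt0//; lra.
set e1 := e / _ in e10.
have [d d0 hd] := jump_log t0 e10 hjump.
pose D := `|B| + `|fR| + `|fL|.
have D0 : 0 <= D by rewrite !addr_ge0.
have d20 : 0 < d / 2 by lra.
(* Once [q] is at least this constant, the distant terms contribute [D / q * M <= e / 2]. *)
have K0 : 0 <= 2 * D * M / e by rewrite divr_ge0 ?mulr_ge0// ltW.
have [A hA] := near_infty_powR_ge nu0 d20 K0.
exists A => w /hA[dw1 dwK] w0 wZ; set L := w * ln t in wZ *.
pose a k := chi (expR (L - k%:~R)).
pose mean k : R := w * \int[completed_lebesgue_measure]_(u in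
            [set` `[k%:~R / w, (k + 1)%:~R / w]]) f (expR u).
pose c k : R := if L < k%:~R then fR else fL.
have kL (k : int) : k%:~R != L by apply: contraNneq wZ => <-; exact: intr_int.
pose q := (d / 2 * w) `^ nu.
have q0 : 0 < q by rewrite powR_gt0//; lra.
have mean_D k : `|mean k - c k| <= D.
  apply: mean_close => // u _.
  rewrite (le_trans (ler_normB _ _))// /D -addrA lerD//.
    by rewrite (le_trans (hB _ _)) ?ler_norm//; exact: expR_gt0.
  by rewrite /c; case: ifP; rewrite ?lerDl ?lerDr.
(* On the interval, [|u * w - L|] is at most [|k - L| + 1], hence less than [d * w] because
   [1 <= d / 2 * w]; so [u] is within [d] of [ln t]. *)
have mean_e k : a k != 0 -> `|k%:~R - L| < d / 2 * w -> `|mean k - c k| <= e1.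
  move=> ak kd; apply: mean_close => // u /andP[].
  rewrite ler_pdivrMr// ler_pdivlMr// => ku uk.
  have uL : `|u * w - L| = `|u - ln t| * w.
    by rewrite -{2}(gtr0_norm w0) -normrM mulrBl /L [ln t * w]mulrC.
  have LE : L = ln t * w by rewrite /L mulrC.
  rewrite /c; have := kL k; case: ltgtP => // Lk _.
  - have udt : `|u - ln t| < d.
      rewrite -(ltr_pM2r w0) -uL; move: kd; rewrite !ltr_norml => /andP[? ?].
      by rewrite intrD in uk; lra.
    apply: (hd u udt).1; rewrite -(ltr_pM2r w0) -LE; exact: lt_le_trans ku.
  - have udt : `|u - ln t| < d.
      rewrite -(ltr_pM2r w0) -uL; move: kd; rewrite !ltr_norml => /andP[? ?].
      by rewrite intrD in uk; lra.
    apply: (hd u udt).2; rewrite -(ltr_pM2r w0) -LE.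
    (* An interval starting left of [ln t] could reach it only if [k < L < k + 1]; then
       [expR (L - k)] lies in [(1, e)] and [a k] vanishes. *)
    apply: (le_lt_trans uk); rewrite ltNge le_eqVlt eq_sym (negbTE (kL _)) /=.
    apply: contra ak => Lk1; apply/eqP; apply: chi0.
    by rewrite -{1}expR0 !ltr_expR; rewrite intrD in Lk1; apply/andP; split; lra.
have hterm k : `|a k * (mean k - c k)| <=
    `|e1 * a k| + `|D / q * (a k * `|k%:~R - L| `^ nu)|.
  have [ak0|ak0] := eqVneq (a k) 0.
    by rewrite ak0 mul0r normr0 addr_ge0.
  have [kd|kd] := ltP `|k%:~R - L| (d / 2 * w).
    rewrite (@le_trans _ _ `|e1 * a k|) ?lerDl//.
    by rewrite (normrM (a k)) (normrM e1) mulrC (gtr0_norm e10) ler_wpM2r// mean_e.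
  (* For a distant index, [|k - L|] to the power [nu] is at least [q], so inserting this weight
     divided by [q] only enlarges the term. *)
  rewrite (@le_trans _ _ `|D / q * (a k * `|k%:~R - L| `^ nu)|) ?lerDr//.
  rewrite !normrM mulrCA ler_wpM2l// (ger0_norm (powR_ge0 _ _)) (ger0_norm D0).
  rewrite normfV (gtr0_norm q0) -mulrA (le_trans (mean_D k))// ler_peMr//.
  rewrite mulrC ler_pdivlMr// mul1r /q.
  by apply: ge0_ler_powR; rewrite ?nnegrE ?(ltW nu0)//; lra.
have hsum := abs_sums_leD hterm
  (abs_sums_leZ e1 (hC L)) (abs_sums_leZ (D / q) (hM L)).
have [cv_err le_err] := abs_sums_le_sumZ hsum.
have -> : kantorovich chi f w t = sumZ (fun k => a k * mean k).
  congr sumZ; apply/funext => k; congr (chi _ * _).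
  by rewrite /powR gt_eqF// -expRD addrC.
have split_a k : a k * mean k = a k * (mean k - c k) +
    (fR * (if L < k%:~R then a k else 0) + fL * (if k%:~R < L then a k else 0)).
  rewrite /c; have := kL k; case: ltgtP => // _ _; lra.
under eq_fun do rewrite split_a.
have cvm := cvgZ_kernel_if hchi (fun k => L < k%:~R) L.
have cvp := cvgZ_kernel_if hchi (fun k => k%:~R < L) L.
rewrite sumZD//; last by apply: cvgZD; exact: cvgZM.
rewrite sumZD; [|exact: cvgZM..].
rewrite !sumZM// -/(a _) psi_minusE psi_plusE addrK.
apply: (le_trans le_err).
rewrite (gtr0_norm e10) (ger0_norm (divr_ge0 D0 (ltW q0))).
have h1 : e1 * C <= e / 2.
  rewrite /e1 mulrAC ler_pdivrMr; last by lra.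
  by nra.
have h2 : D / q * M <= e / 2.
  rewrite mulrAC ler_pdivrMr//.
  by move: dwK; rewrite -/q ler_pdivrMr//; lra.
by lra.
Qed.

(** * Large parameters with a prescribed residue modulo 1 *)

(** Dividing by a negative [l] reverses the inequality, so the integer is taken just above the floor
    when [l > 0] and strictly below it when [l < 0]. *)
Lemma exists_gt_mul_shift (R : realType) (l r A : R) : l != 0 ->
  exists w (m : int), A < w /\ w * l = r + m%:~R.
Proof.
move=> l0; have /andP[f1 f2] := floor_itv (A * l - r).
set n := Num.floor _ in f1 f2.
have [lp|ln|/eqP] := ltgtP 0 l; last by rewrite eq_sym (negbTE l0).
  exists ((r + (n + 1)%:~R) / l), (n + 1); rewrite divfK//; split => //.
  by rewrite ltr_pdivlMr//; lra.
exists ((r + (n - 1)%:~R) / l), (n - 1); rewrite divfK//; split => //.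
by rewrite ltr_ndivlMr// intrB; lra.
Qed.

Lemma nonint_itv01 (R : realType) (r : R) (m : int) : 0 < r < 1 ->
  r + m%:~R \isn't a Num.int.
Proof.
move=> /andP[r0 r1]; apply/negP => /intrP[k /eqP].
rewrite -subr_eq0 -addrA -intrB => /eqP rk.
have : (0 < k - m)%R by rewrite -(ltr_int R) !intrB; move: rk; rewrite intrB; lra.
have : (k - m < 1)%R by rewrite -(ltr_int R) !intrB; move: rk; rewrite intrB; lra.
lia.
Qed.

(** * Equivalence of the limit with the two conditions on the truncated sums *)

Unset Implicit Arguments.
Set Strict Implicit.

Theorem theorem3 (R : realType) (chi f : R -> R) (t alpha : R)
  (hchi : is_kernel chi)
  (hfm : lebesgue_measurable Rplus f)
  (hfb : [bounded f x | x in Rplus])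
  (ht : 0 < t) (ht1 : t <> 1)
  (hjump : jump_discontinuity f t)
  (hchi0 : forall u : R, 1 < u < expR 1 -> chi u = 0) :
  (kantorovich chi f w t @[w --> nonint_infty t] -->
     alpha * right_lim f t + (1 - alpha) * left_lim f t
   <-> (forall u : R, 1 < u < expR 1 -> psi_minus chi u = alpha))
  /\
  ((forall u : R, 1 < u < expR 1 -> psi_minus chi u = alpha)
   <-> (forall u : R, 1 < u < expR 1 -> psi_plus chi u = 1 - alpha)).
Proof.
have uE (u : R) : 1 < u < expR 1 -> exists2 r, 0 < r < 1 & u = expR r.
  move=> /andP[u1 ue]; have u0 : 0 < u by lra.
  exists (ln u); last by rewrite lnK.
  by rewrite ln_gt0 //= -ltr_expR lnK.
have psi1 (r : R) : 0 < r < 1 ->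
    psi_minus chi (expR r) + psi_plus chi (expR r) = 1.
  by move=> /(nonint_itv01 0); rewrite addr0; exact: psi_minus_plus.
split; last first.
  by split=> h u uI; have := h u uI; have [r /psi1 + ->] := uE u uI; lra.
split=> [/nonint_inftyP hlim u /uE[r r01 ->]|hpsi].
  have [_ _ /eqP] := hjump; rewrite -subr_eq0 => J0.
  have lnt0 : ln t != 0 by rewrite ln_eq0//; apply/eqP.
  apply/eqP; apply: contraT; rewrite -subr_eq0 => P0.
  (* This is the gap between the asymptotic value at residue [r] and the assumed limit. Both
     approximate the series within [|x| / 4], which forces [|x| <= |x| / 2], impossible for nonzero
     [x]. *)
  pose x := (psi_minus chi (expR r) - alpha) * (right_lim f t - left_lim f t).
  have x0 : 0 < `|x| by rewrite normr_gt0 mulf_neq0.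
  have e0 : 0 < `|x| / 4 by lra.
  have [A1 h1] := hlim _ e0.
  have [A2 h2] := kantorovich_asymp hchi hfb ht hjump hchi0 e0.
  (* The absolute values put [w] beyond both thresholds and make it positive. *)
  have [w [m [Aw wl]]] := exists_gt_mul_shift r (`|A1| + `|A2|) lnt0.
  have A1w : A1 < w by rewrite (le_lt_trans _ Aw)// (le_trans (ler_norm _))// lerDl.
  have A2w : A2 < w by rewrite (le_lt_trans _ Aw)// (le_trans (ler_norm _))// lerDr.
  have w0 : 0 < w by rewrite (le_lt_trans _ Aw)// addr_ge0.
  have wZ : w * ln t \isn't a Num.int by rewrite wl nonint_itv01.
  have {}h1 := h1 w A1w w0 wZ; have {}h2 := h2 w A2w w0 wZ.
  have := psi_minus_plus hchi wZ; move: h2; rewrite wl psi_minus_periodic//.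
  set P := psi_minus _ _ in x x0 e0 h1 *; set Q := psi_plus _ _ => h2 PQ.
  have : `|x| <= `|x| / 4 + `|x| / 4.
    rewrite {1}(_ : x = (kantorovich chi f w t -
        (alpha * right_lim f t + (1 - alpha) * left_lim f t)) -
        (kantorovich chi f w t - (right_lim f t * P + left_lim f t * Q))).
      by rewrite (le_trans (ler_normB _ _))// lerD.
    by rewrite (_ : Q = 1 - P) /x; [lra|rewrite -PQ addrC addKr].
  by lra.
apply/nonint_inftyP => e e0.
have [A hA] := kantorovich_asymp hchi hfb ht hjump hchi0 e0.
exists A => w Aw w0 wZ; have := hA w Aw w0 wZ.
have := psi_minus_plus hchi wZ.
have /andP[f1 f2] := floor_itv (w * ln t).
set L := w * ln t in wZ f1 f2 *; set n := Num.floor L in f1 f2.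
have -> : psi_minus chi (expR L) = alpha.
  (* By periodicity [L] may be replaced by its fractional part, which is strictly positive as [L] is
     not an integer, so its exponential lies in [(1, e)]. *)
  rewrite -(subrK n%:~R L) psi_minus_periodic// hpsi//.
  rewrite -{1}expR0 !ltr_expR subr_gt0 ltrBlDl -intrD1 f2 andbT.
  rewrite lt_neqAle f1 andbT; apply: contraNneq wZ => <-; exact: intr_int.
move=> PQ; rewrite (_ : psi_plus _ _ = 1 - alpha); last by lra.
by rewrite [right_lim f t * _]mulrC [left_lim f t * _]mulrC.
Qed.
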